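(* Let $\bar x\in\mathbb{R}^n$ be an AM-stationary point of the inequality-constrained problem (P): $\min_x f(x)$ s.t. $g(x)\le0$. Then ODP-subMFC holds at $\bar x$ if and only if there exist $I\subset I^g(\bar x)$ and a sequence $\{(x^k,\lambda^k,\delta^k,\varepsilon^k)\}_{k=1}^\infty\subset\mathbb{R}^n\times\mathbb{R}^\ell\times\mathbb{R}^\ell\times\mathbb{R}^n$ such that the following conditions hold. (i) Either $I=\emptyset$, or for all $u\in\mathbb{R}^\ell\setminus\{0\}$ with $u\ge0$ and $u_i=0$ for all $i\in[\ell]\setminus I$ it holds that $0\neq\sum_{i\in I}u_i\nabla g_i(\bar x)$. (ii) $(x^k,\delta^k,\varepsilon^k)\to(\bar x,0,0)$, and for all $k\in\mathbb{N}$: $\varepsilon^k=\nabla f(x^k)+\sum_{i=1}^\ell\lambda_i^k\nabla g_i(x^k)$; $\lambda_i^k\ge0$ for all $i\in I^g(x^k,\delta^k)$; $\lambda_i^k=0$ for all $i\in[\ell]\setminus I^g(x^k,\delta^k)$; $g(x^k)\le\delta^k$; and $I=I^g(x^k,\delta^k)$.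
   Context: $f\colon\mathbb{R}^n\to\mathbb{R}$ and $g\colon\mathbb{R}^n\to\mathbb{R}^m$ are continuously differentiable, $\ell=m$, $[\ell]=\{1,\dots,\ell\}$, $\operatorname{sgn}\colon\mathbb{R}\to\{-1,0,1\}$ is the sign function. For $g(x)\le\delta$ let $I^g(x,\delta)=\{i\in[\ell]\mid g_i(x)=\delta_i\}$ and $I^g(\bar x)=I^g(\bar x,0)$. (P) is viewed as the orthodisjunctive problem $\min_x f(x)$ s.t. $F(x)\in\Gamma$ with $F=g$ and $\Gamma=(-\infty,0]^\ell$ (a single product of intervals). In this case: let $N_\Gamma(y)$ be the normal cone of convex analysis to $\Gamma$ at $y$, with $N_\Gamma(y)=\emptyset$ for $y\notin\Gamma$. A sequence $\{(x^k,\lambda^k,\delta^k,\varepsilon^k)\}_{k=1}^\infty$ is approximately M-stationary w.r.t. a feasible point $\bar x$ if $(x^k,\delta^k,\varepsilon^k)\to(\bar x,0,0)$ and, for all $k$, $\varepsilon^k=\nabla f(x^k)+g'(x^k)^\top\lambda^k$ and $\lambda^k\in N_\Gamma(g(x^k)-\delta^k)$. $\bar x$ is AM-stationary if such a sequence exists. Convention: passing to subsequences, all approximately M-stationary sequences considered are taken such that $I^g(x^k,\delta^k)$ and the signs $\operatorname{sgn}(\lambda_i^k)$, $i\in[\ell]$, do not depend on $k$. ODP-subMFC holds at an AM-stationary point $\bar x$ if there exist $I\subset I^g(\bar x)$ and a sequence $\{(x^k,\lambda^k,\delta^k,\varepsilon^k)\}_{k=1}^\infty$ such that: either $I=\emptyset$,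 or for all $u\in\mathbb{R}^\ell\setminus\{0\}$ with $u\ge0$ and $u_{[\ell]\setminus I}=0$, $0\neq\sum_{i\in I}\operatorname{sgn}(\lambda_i^k)u_i\nabla g_i(\bar x)$; and the sequence is approximately M-stationary w.r.t. $\bar x$ with $I=I^g(x^k,\delta^k)$ for all $k\in\mathbb{N}$. *)

(* Defs.v *)
From HB Require Import structures.
From mathcomp Require Import all_boot all_order all_algebra.
From mathcomp Require Import all_classical all_reals all_analysis.

Set Implicit Arguments.
Unset Strict Implicit.
Unset Printing Implicit Defensive.

Import Order.TTheory GRing.Theory Num.Theory.
Import numFieldNormedType.Exports.

Local Open Scope classical_set_scope.
Local Open Scope ring_scope.

(* Vectors of R^n are row vectors; the topology of 'rV[R]_n is that of the
   maximum norm, i.e. the usual one. *)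

(* Stated for any codomain so that it covers both f : R^n -> R and
   g : R^n -> R^m. *)
Definition continuously_differentiable (R : realType) (n : nat)
    (W : normedModType R) (h : 'rV[R]_n -> W) : Prop :=
  (forall x, differentiable h x) /\
  (forall j : 'I_n, continuous (fun x => 'D_(delta_mx 0 j) h x)).

Definition grad (R : realType) (n : nat) (h : 'rV[R]_n -> R) (x : 'rV[R]_n) :
    'rV[R]_n :=
  \row_(j < n) 'D_(delta_mx 0 j) h x.

Definition component (R : realType) (n m : nat) (g : 'rV[R]_n -> 'rV[R]_m)
    (i : 'I_m) : 'rV[R]_n -> R :=
  fun x => g x 0 i.

Definition active (R : realType) (n m : nat) (g : 'rV[R]_n -> 'rV[R]_m)
    (x : 'rV[R]_n) (delta : 'rV[R]_m) : {set 'I_m} :=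
  [set i | g x 0 i == delta 0 i]%SET.

Definition nonpos_orthant (R : realType) (m : nat) : set 'rV[R]_m :=
  [set y : 'rV[R]_m | forall i, y 0 i <= 0].

(* Empty when y is not in Gamma. *)
Definition normal_cone (R : realType) (m : nat) (Gamma : set 'rV[R]_m)
    (y : 'rV[R]_m) : set 'rV[R]_m :=
  [set l : 'rV[R]_m | Gamma y /\
            forall z, Gamma z -> \sum_(i < m) l 0 i * (z 0 i - y 0 i) <= 0].

(* 'J F x is the matrix acting on row vectors from the right, i.e. the
   transpose of the m x n matrix F'(x). Hence lam *m ('J F x)^T is the row
   vector of F'(x)^T lam. *)
Definition approx_M_stationary (R : realType) (n m : nat)
    (f : 'rV[R]_n -> R) (F : 'rV[R]_n -> 'rV[R]_m) (Gamma : set 'rV[R]_m)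
    (xbar : 'rV[R]_n) (x : nat -> 'rV[R]_n) (lam : nat -> 'rV[R]_m)
    (delta : nat -> 'rV[R]_m) (eps : nat -> 'rV[R]_n) : Prop :=
  [/\ x @ \oo --> xbar, delta @ \oo --> (0 : 'rV[R]_m),
      eps @ \oo --> (0 : 'rV[R]_n),
      forall k, eps k = grad f (x k) + lam k *m ('J F (x k))^T
    & forall k, normal_cone Gamma (F (x k) - delta k) (lam k)].

Definition AM_stationary (R : realType) (n m : nat)
    (f : 'rV[R]_n -> R) (F : 'rV[R]_n -> 'rV[R]_m) (Gamma : set 'rV[R]_m)
    (xbar : 'rV[R]_n) : Prop :=
  Gamma (F xbar) /\
  exists x lam delta eps, approx_M_stationary f F Gamma xbar x lam delta eps.

(* The standing convention on approximately M-stationary sequences, which can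
   always be achieved by passing to a subsequence. *)
Definition stable_pattern (R : realType) (n m : nat)
    (g : 'rV[R]_n -> 'rV[R]_m) (x : nat -> 'rV[R]_n)
    (lam delta : nat -> 'rV[R]_m) : Prop :=
  forall k k',
    active g (x k) (delta k) = active g (x k') (delta k') /\
    (forall i, Num.sg (lam k 0 i) = Num.sg (lam k' 0 i)).

(* ODP-subMFC for the constraint g(x) in (-oo, 0]^m. By stable_pattern the
   signs do not depend on k, so quantifying over all k in the second conjunct
   is the same as fixing one. *)
Definition ODP_subMFC (R : realType) (n m : nat)
    (f : 'rV[R]_n -> R) (g : 'rV[R]_n -> 'rV[R]_m) (xbar : 'rV[R]_n) : Prop :=
  exists (I : {set 'I_m}) (x : nat -> 'rV[R]_n) (lam delta : nat -> 'rV[R]_m)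
         (eps : nat -> 'rV[R]_n),
  [/\ I \subset active g xbar 0,
      I = finset.set0 \/
      (forall (k : nat) (u : 'rV[R]_m), u != 0 -> (forall i, 0 <= u 0 i) ->
         (forall i, i \notin I -> u 0 i = 0) ->
         0 != \sum_(i in I)
                (Num.sg (lam k 0 i) * u 0 i) *: grad (component g i) xbar),
      approx_M_stationary f g (@nonpos_orthant R m) xbar x lam delta eps,
      stable_pattern g x lam delta
    & forall k, I = active g (x k) (delta k)].

(* Main.v *)
Require Import Defs.
From mathcomp Require Import all_boot all_order all_algebra.
From mathcomp Require Import all_classical all_reals all_analysis.
Import Order.TTheory GRing.Theory Num.Theory.
Import numFieldNormedType.Exports.
Local Open Scope classical_set_scope.
Local Open Scope ring_scope.

(** In every approximately stationary sequence for [g x <= 0] the multipliers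
    are nonnegative and supported on the active set
    ([normal_cone_activeP]), so on [I] their signs are 0 or 1.  The
    two sides of the equivalence differ only in these signs.

    If ODP-subMFC holds and [I] is nonempty, no multiplier with index [i] in
    [I] can vanish: otherwise the unit vector [u] at [i] would make the signed
    combination of gradients zero
    ([sg_neq0_of_signed_independence]).  So all signs on [I] are 1, and the
    signed condition is exactly positive linear independence of the gradients.

    Conversely, nonnegative multipliers supported on [I] may vanish on [I], or
    their vanishing may vary along the sequence, so they do not have to satisfy
    the signed condition or the sign convention.  Adding a number [t k > 0]
    to every active multiplier makes all signs on [I] equal to 1 for every
    index at once, without passing to a subsequence.  It changes the residual by
    [t k] times the sum of the active gradients at [x k], which still tends to
    zero when [t k] is small enough ([exists_pos_scale_cvg0]). *)

Lemma grad_component (R : realType) (n m : nat) (g : 'rV[R]_n -> 'rV[R]_m)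
    (x : 'rV[R]_n) (i : 'I_m) :
  differentiable g x -> grad (component g i) x = row i ('J g x)^T.
Proof.
move=> dg; apply/rowP => j; rewrite !mxE.
have dv : derivable g x (delta_mx 0 j) by exact: diff_derivable.
by rewrite -deriveE // derive_mx // mxE.
Qed.

Lemma mul_trmx_jacobian (R : realType) (n m : nat)
    (g : 'rV[R]_n -> 'rV[R]_m) (x : 'rV[R]_n) (l : 'rV[R]_m) :
  differentiable g x ->
  l *m ('J g x)^T = \sum_(i < m) l 0 i *: grad (component g i) x.
Proof.
by move=> dg; rewrite mulmx_sum_row; apply: eq_bigr => i _; rewrite grad_component.
Qed.

(** Moving [y] down along a coordinate stays in the orthant, which forces
    [l i >= 0]; raising a negative coordinate to 0 also stays in it, which
    forces [l i <= 0]. *)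
Lemma normal_cone_nonpos_orthantP (R : realType) (m : nat) (y l : 'rV[R]_m) :
  normal_cone (@nonpos_orthant R m) y l <->
  [/\ forall i, y 0 i <= 0, forall i, 0 <= l 0 i
    & forall i, y 0 i != 0 -> l 0 i = 0].
Proof.
split=> [[y0 ly]|[y0 l0 ly]]; last first.
  split=> // z z0; apply: sumr_le0 => i _.
  have [yi0|/ly->] := eqVneq (y 0 i) 0; last by rewrite mul0r.
  by rewrite yi0 subr0; apply: mulr_ge0_le0 => //; exact: z0.
have shift i c : y 0 i + c <= 0 -> l 0 i * c <= 0.
  move=> yc; have := ly (y + c *: delta_mx 0 i).
  rewrite (bigD1 i) //= big1 => [|j ji]; last first.
    by rewrite !mxE (negbTE ji) andbF mulr0 addr0 subrr mulr0.
  rewrite !mxE !eqxx mulr1 addr0 addrAC subrr add0r; apply=> j.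
  rewrite !mxE eqxx /=; have [->|_] := eqVneq j i; first by rewrite mulr1.
  by rewrite mulr0 addr0; exact: y0.
have l0 i : 0 <= l 0 i.
  have := shift i (-1); rewrite mulrN1 oppr_le0; apply.
  by rewrite subr_le0 (le_trans (y0 i)).
split=> // i yi; apply/eqP; rewrite eq_le l0 andbT.
have yi0 : 0 < - y 0 i by rewrite oppr_gt0 lt_neqAle yi y0.
by rewrite -(pmulr_lle0 _ yi0) shift // subrr.
Qed.

Lemma normal_cone_activeP (R : realType) (n m : nat)
    (g : 'rV[R]_n -> 'rV[R]_m) (x : 'rV[R]_n) (delta l : 'rV[R]_m) :
  normal_cone (@nonpos_orthant R m) (g x - delta) l <->
  [/\ forall i, g x 0 i <= delta 0 i, forall i, 0 <= l 0 i
    & forall i, i \notin active g x delta -> l 0 i = 0].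
Proof.
rewrite normal_cone_nonpos_orthantP; split=> -[h1 h2 h3]; split=> // i.
- by have := h1 i; rewrite !mxE subr_le0.
- by rewrite inE => gi; apply: h3; rewrite !mxE subr_eq0.
- by rewrite !mxE subr_le0.
- by rewrite !mxE subr_eq0 => gi; apply: h3; rewrite inE.
Qed.

(** Dividing by [1 + `|v k|] absorbs any growth of [v]. *)
Lemma exists_pos_scale_cvg0 (R : realType) (V : normedModType R)
    (v : nat -> V) :
  exists t : nat -> R, (forall k, 0 < t k) /\
    (fun k => t k *: v k) @ \oo --> (0 : V).
Proof.
have v1 k : 0 < 1 + `|v k| by rewrite ltr_pwDl.
exists (fun k => harmonic k / (1 + `|v k|)); split.
  by move=> k; rewrite divr_gt0 // harmonic_gt0.
apply: norm_cvg0; apply: (squeeze_cvgr _ (cvg_cst 0) cvg_harmonic).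
apply: nearW => k /=; rewrite normr_ge0 /= normrZ ger0_norm; last first.
  by rewrite divr_ge0 ?harmonic_ge0 // ltW.
by rewrite -mulrA ger_pMr ?harmonic_gt0 // mulrC ler_pdivrMr // mul1r lerDr.
Qed.

(** Otherwise the unit vector at [i] is an admissible [u] for which the signed
    combination is zero. *)
Lemma sg_neq0_of_signed_independence (R : realType) (V : lmodType R) (m : nat)
    (I : {set 'I_m}) (s : 'I_m -> R) (v : 'I_m -> V) :
  (forall u : 'rV[R]_m, u != 0 -> (forall i, 0 <= u 0 i) ->
     (forall i, i \notin I -> u 0 i = 0) ->
     0 != \sum_(i in I) (s i * u 0 i) *: v i) ->
  forall i, i \in I -> s i != 0.
Proof.
move=> ind i iI; apply/eqP => si; have := ind (delta_mx 0 i).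
rewrite big1 => [|j _]; last first.
  by rewrite mxE; have [->|_] := eqVneq j i; rewrite ?si ?mul0r ?mulr0 scale0r.
rewrite eqxx => H; suff: false by [].
apply: H => [|j|j jI].
- by apply/eqP => /rowP /(_ i); rewrite !mxE !eqxx => /eqP; rewrite oner_eq0.
- by rewrite mxE ler0n.
- by rewrite mxE; have [ji|] := eqVneq j i; rewrite ?andbF //; rewrite ji iI in jI.
Qed.


Theorem lemma4p13 (R : realType) (n m : nat)
    (f : 'rV[R]_n -> R) (g : 'rV[R]_n -> 'rV[R]_m)
    (hf : continuously_differentiable f) (hg : continuously_differentiable g)
    (xbar : 'rV[R]_n)
    (hx : AM_stationary f g (@nonpos_orthant R m) xbar) :
  ODP_subMFC f g xbar <->
  exists (I : {set 'I_m}) (x : nat -> 'rV[R]_n) (lam delta : nat -> 'rV[R]_m)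
         (eps : nat -> 'rV[R]_n),
    [/\ I \subset active g xbar 0,
        (* (i) *)
        I = finset.set0 \/
        (forall u : 'rV[R]_m, u != 0 -> (forall i, 0 <= u 0 i) ->
           (forall i, i \notin I -> u 0 i = 0) ->
           0 != \sum_(i in I) u 0 i *: grad (component g i) xbar),
        (* (ii) *)
        [/\ x @ \oo --> xbar, delta @ \oo --> (0 : 'rV[R]_m)
          & eps @ \oo --> (0 : 'rV[R]_n)]
      & forall k : nat,
        [/\ eps k = grad f (x k)
                    + \sum_(i < m) lam k 0 i *: grad (component g i) (x k),
            (forall i, i \in active g (x k) (delta k) -> 0 <= lam k 0 i),
            (forall i, i \notin active g (x k) (delta k) -> lam k 0 i = 0),
            (forall i, g (x k) 0 i <= delta k 0 i)
          & I = active g (x k) (delta k)]].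
Proof.
have dg y : differentiable g y := hg.1 y.
split=> -[I [x [lam [delta [eps]]]]].
- move=> [Iact ind [cx cd ce epsE nc] _ IE].
  exists I, x, lam, delta, eps.
  have lamP k := iffLR (normal_cone_activeP _ _ _ _ _ _ _) (nc k).
  split=> // [|k]; last first.
    by have [gle l0 l0'] := lamP k; split=> //; rewrite -mul_trmx_jacobian.
  case: ind => [->|ind]; [by left | right => u u0 upos usupp].
  have := ind 0%N u u0 upos usupp; congr (0 != _).
  apply: eq_bigr => i iI; congr (_ *: _).
  have [_ l0 _] := lamP 0%N.
  have := sg_neq0_of_signed_independence _ _ _ _ _ _ (ind 0%N) i iI.
  by rewrite sgr_eq0 => li; rewrite gtr0_sg ?mul1r // lt_neqAle eq_sym li l0.
- move=> [Iact ind [cx cd ce] seqP].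
  pose v k := \sum_(i in I) grad (component g i) (x k).
  have [t [t0 tv]] := exists_pos_scale_cvg0 _ _ v.
  pose lam' k : 'rV[R]_m := \row_i (lam k 0 i + if i \in I then t k else 0).
  have lam'_gt0 k i : i \in I -> 0 < lam' k 0 i.
    move=> iI; have [_ l0 _ _ IE] := seqP k.
    by rewrite mxE iI ltr_wpDl //; apply: l0; rewrite -IE.
  have lam'_eq0 k i : i \notin I -> lam' k 0 i = 0.
    move=> iI; have [_ _ l0 _ IE] := seqP k.
    by rewrite mxE (negbTE iI) addr0 l0 // -IE.
  have sg_lam' k i : Num.sg (lam' k 0 i) = (i \in I)%:R.
    have [iI|iI] := boolP (i \in I); first by rewrite gtr0_sg // lam'_gt0.
    by rewrite lam'_eq0 // sgr0.
  exists I, x, lam', delta, (fun k => eps k + t k *: v k); split=> //.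
  + case: ind => [->|ind]; [by left | right => k u u0 upos usupp].
    have := ind u u0 upos usupp; congr (0 != _).
    by apply: eq_bigr => i iI; rewrite sg_lam' iI mul1r.
  + split=> // [|k|k].
    * have := cvgD ce tv; rewrite addr0; exact.
    * have [-> _ _ _ _] := seqP k.
      rewrite mul_trmx_jacobian // -addrA; congr (_ + _).
      rewrite scaler_sumr [X in _ + X]big_mkcond -big_split /=; apply: eq_bigr => i _.
      by rewrite mxE scalerDl; case: ifP => // _; rewrite scale0r.
    * have [_ _ _ gle IE] := seqP k; apply/normal_cone_activeP; split=> // i.
        have [iI|iI] := boolP (i \in I); first exact/ltW/lam'_gt0.
        by rewrite lam'_eq0.
      by rewrite -IE; exact: lam'_eq0.
  + move=> k k'; have [_ _ _ _ <-] := seqP k; have [_ _ _ _ <-] := seqP k'.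
    by split=> // i; rewrite !sg_lam'.
  + by move=> k; have [] := seqP k.
Qed.
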